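(* Let $k\geq 1$ and $n\geq 2$ be integers. Then $\operatorname{sdepth}(I(P_n^k))\geq\left\lceil\frac{n}{2k+1}\right\rceil+1$.
   Context: $K$ is a field and $S=K[x_1,\dots,x_n]$ is the polynomial ring. $P_n^k$ denotes the $k$-th power of the path on the vertex set $\{1,\dots,n\}$: for $1\le i<j\le n$, $\{i,j\}$ is an edge if and only if $j-i\le k$. Its edge ideal is $I(P_n^k)=(x_ix_j : 1\le i<j\le n,\ j-i\le k)\subset S$, regarded as a $\mathbb{Z}^n$-graded $S$-module. Stanley depth: let $M$ be a finitely generated $\mathbb{Z}^n$-graded $S$-module. A Stanley decomposition of $M$ is a presentation of the $K$-vector space $M$ as a finite direct sum $\mathcal{D}: M=\bigoplus_{i=1}^s v_iK[W_i]$, where each $v_i\in M$ is homogeneous, $W_i\subseteq\{x_1,\dots,x_n\}$, $v_iK[W_i]$ is the $K$-subspace generated by all $v_iw$ with $w$ a monomial in $K[W_i]$, and $v_iK[W_i]$ is a free $K[W_i]$-module. Put $\operatorname{sdepth}(\mathcal{D})=\min_i |W_i|$, and $\operatorname{sdepth}(M)=\max\{\operatorname{sdepth}(\mathcal{D}):\mathcal{D}\text{ a Stanley decomposition of }M\}$. *)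

(* Defs.v *)
From HB Require Import structures.
From mathcomp Require Import all_boot all_order all_algebra.
From mathcomp Require Import boolp.
From mathcomp Require Import mpoly.

Set Implicit Arguments.
Unset Strict Implicit.
Unset Printing Implicit Defensive.

Import GRing.Theory.
Local Open Scope ring_scope.

Definition zdegree (n : nat) : Type := {ffun 'I_n -> int}.
HB.instance Definition _ n := Equality.on (zdegree n).

Definition zdeg (n : nat) (m : 'X_{1..n}) : zdegree n :=
  [ffun i => (m i)%:Z].

(* Z^n-graded modules over S = K[x_1, ..., x_n], given by their homogeneous
   components; finite generation is not part of the structure. *)
Record gradedModule (K : fieldType) (n : nat) := GradedModule {
  gm_car :> lmodType {mpoly K[n]};
  gm_comp : zdegree n -> gm_car -> Prop;
  gm_comp0 : forall a, gm_comp a 0;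
  gm_compD : forall a (c : K) u v,
    gm_comp a u -> gm_comp a v -> gm_comp a (c%:MP *: u + v);
  gm_compX : forall a (m : 'X_{1..n}) v,
    gm_comp a v -> gm_comp [ffun i => a i + zdeg m i] ('X_[m] *: v);
  gm_span : forall v, exists (A : seq (zdegree n)) (u : zdegree n -> gm_car),
    (forall a, gm_comp a (u a)) /\ v = \sum_(a <- A) u a;
  gm_indep : forall (A : seq (zdegree n)) (u : zdegree n -> gm_car),
    uniq A -> (forall a, gm_comp a (u a)) -> \sum_(a <- A) u a = 0 ->
    forall a, a \in A -> u a = 0
}.

Definition gm_homogeneous (K : fieldType) (n : nat) (M : gradedModule K n)
  (v : M) : Prop := exists a, gm_comp a v.

(* p belongs to the subring K[W] *)
Definition poly_in_vars (K : fieldType) (n : nat) (W : {set 'I_n})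
    (p : {mpoly K[n]}) : Prop :=
  forall m : 'X_{1..n}, m \in msupp p -> forall i, m i != 0%N -> i \in W.

(* u belongs to v K[W] *)
Definition stanley_space (K : fieldType) (n : nat) (M : gradedModule K n)
    (v : M) (W : {set 'I_n}) (u : M) : Prop :=
  exists p : {mpoly K[n]}, poly_in_vars W p /\ u = p *: v.

(* v K[W] is free over K[W] with basis v; in particular v != 0 *)
Definition stanley_free (K : fieldType) (n : nat) (M : gradedModule K n)
    (v : M) (W : {set 'I_n}) : Prop :=
  forall p : {mpoly K[n]}, poly_in_vars W p -> p *: v = 0 -> p = 0.

Record stanleyDecomposition (K : fieldType) (n : nat)
    (M : gradedModule K n) := StanleyDecomposition {
  sd_size : nat;
  sd_gen : 'I_sd_size -> M;
  sd_vars : 'I_sd_size -> {set 'I_n};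
  sd_homogeneous : forall i, gm_homogeneous (sd_gen i);
  sd_free : forall i, stanley_free (sd_gen i) (sd_vars i);
  sd_direct : forall v : M, exists! u : {ffun 'I_sd_size -> M},
    (forall i, stanley_space (sd_gen i) (sd_vars i) (u i)) /\
    v = \sum_i u i
}.
Arguments sd_gen {K n M} D i : rename.
Arguments sd_vars {K n M} D i : rename.

(* Since #|W_i| <= n, the neutral element n only matters for the empty
   decomposition (of the zero module). *)
Definition sdepth_decomp (K : fieldType) (n : nat) (M : gradedModule K n)
    (D : stanleyDecomposition M) : nat :=
  \big[minn/n]_(i < sd_size D) #|sd_vars D i|.

(* Every sdepth_decomp D is at most n, so ranging over d < n.+1 is no
   restriction. *)
Definition sdepth (K : fieldType) (n : nat) (M : gradedModule K n) : nat :=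
  (\max_(d < n.+1 |
     `[< exists D : stanleyDecomposition M, sdepth_decomp D = d >]) d)%N.

(* The vertices 1, ..., n are shifted to 0, ..., n-1. *)
Definition path_power (n k : nat) : rel 'I_n :=
  fun i j => ((i < j) && (j - i <= k) || (j < i) && (i - j <= k))%N.
Arguments path_power : clear implicits.

(* The ideal of S generated by the x_i x_j with i, j adjacent; S^o is S as a
   module over itself. *)
Definition edge_ideal (K : fieldType) (n : nat) (e : rel 'I_n) :
    {pred {mpoly K[n]}^o} :=
  fun p => `[< exists q : 'I_n -> 'I_n -> {mpoly K[n]},
    p = \sum_i \sum_(j | e i j) q i j * ('X_i * 'X_j) >].
Arguments edge_ideal K {n} e.

Section EdgeIdealModule.
Variables (K : fieldType) (n : nat) (e : rel 'I_n).

Fact edge_ideal_submod_closed : GRing.submod_closed (edge_ideal K e).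
Proof.
split=> [|c p p']; rewrite /in_mem /=.
  apply/asboolP; exists (fun _ _ => 0).
  by rewrite big1 // => i _; rewrite big1 // => j _; rewrite mul0r.
move=> /asboolP[q ->] /asboolP[q' ->]; apply/asboolP.
exists (fun i j => c * q i j + q' i j).
rewrite scaler_sumr -big_split; apply: eq_bigr => i _ /=.
rewrite scaler_sumr -big_split; apply: eq_bigr => j _ /=.
by rewrite mulrDl -mulrA.
Qed.

HB.instance Definition _ :=
  GRing.isSubmodClosed.Build {mpoly K[n]} {mpoly K[n]}^o (edge_ideal K e)
    edge_ideal_submod_closed.

Record edge_ideal_mod : Type :=
  EdgeIdealMod { ei_val :> {mpoly K[n]}^o; _ : ei_val \in edge_ideal K e }.
HB.instance Definition _ := [isSub for ei_val].
HB.instance Definition _ := [Choice of edge_ideal_mod by <:].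
HB.instance Definition _ := [SubChoice_isSubZmodule of edge_ideal_mod by <:].
HB.instance Definition _ := [SubZmodule_isSubLmodule of edge_ideal_mod by <:].

Definition ei_comp (a : zdegree n) (p : edge_ideal_mod) : Prop :=
  forall m, m \in msupp (ei_val p : {mpoly K[n]}) -> zdeg m = a.

Lemma edge_ideal_term (p : {mpoly K[n]}) (m : 'X_{1..n}) :
  p \in edge_ideal K e -> p@_m *: 'X_[m] \in edge_ideal K e.
Proof.
rewrite /in_mem /= => /asboolP[q ->]; apply/asboolP.
exists (fun i j =>
  (q i j * ('X_i * 'X_j))@_m *: 'X_[(m - (U_(i) + U_(j)))%MM]).
rewrite raddf_sum scaler_suml; apply: eq_bigr => i _.
rewrite raddf_sum scaler_suml; apply: eq_bigr => j _ /=.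
rewrite -mpolyXD -scalerAl -mpolyXD.
set g := (U_(i) + U_(j))%MM.
have [->|nz] := eqVneq ((q i j * 'X_[g])@_m) 0; first by rewrite !scale0r.
rewrite submK //; move: nz; rewrite -mcoeff_msupp => /=.
by rewrite (perm_mem (msuppMX _ _)) => /mapP[h _ ->]; rewrite lem_addr.
Qed.

Let ei_valD (p q : edge_ideal_mod) : ei_val (p + q) = ei_val p + ei_val q.
Proof. by []. Qed.

Let ei_val_sum (I : Type) (s : seq I) (u : I -> edge_ideal_mod) :
  ei_val (\sum_(a <- s) u a) = \sum_(a <- s) ei_val (u a).
Proof. exact: (big_morph ei_val ei_valD (erefl _)). Qed.

Fact ei_comp0 a : ei_comp a 0.
Proof. by move=> m; rewrite /= msupp0. Qed.

Fact ei_compD a (c : K) u v :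
  ei_comp a u -> ei_comp a v -> ei_comp a (c%:MP *: u + v).
Proof.
move=> hu hv m; rewrite mcoeff_msupp.
have -> : ei_val (c%:MP *: u + v) = c *: (ei_val u : {mpoly K[n]}) + ei_val v.
  by rewrite -mul_mpolyC.
have [/hv //|/memN_msupp_eq0 v0] :=
  boolP (m \in msupp (ei_val v : {mpoly K[n]})).
have [/hu //|/memN_msupp_eq0 u0] :=
  boolP (m \in msupp (ei_val u : {mpoly K[n]})).
by rewrite mcoeffD mcoeffZ v0 u0 mulr0 addr0 eqxx.
Qed.

Fact ei_compX a (m : 'X_{1..n}) v :
  ei_comp a v -> ei_comp [ffun i => a i + zdeg m i] ('X_[m] *: v).
Proof.
move=> hv m'.
have -> : ei_val ('X_[m] *: v) = (ei_val v : {mpoly K[n]}) * 'X_[m].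
  by rewrite mulrC.
rewrite (perm_mem (msuppMX _ _)) => /mapP[h /hv <- ->].
by apply/ffunP=> i; rewrite !ffunE mnmDE PoszD addrC.
Qed.

Fact ei_span (v : edge_ideal_mod) :
  exists (A : seq (zdegree n)) (u : zdegree n -> edge_ideal_mod),
    (forall a, ei_comp a (u a)) /\ v = \sum_(a <- A) u a.
Proof.
pose mon (a : zdegree n) : 'X_{1..n} := [multinom absz (a i) | i < n].
have monK m : mon (zdeg m) = m.
  by apply/mnmP=> i; rewrite mnmE ffunE.
pose t a := EdgeIdealMod (edge_ideal_term (mon a) (valP v)).
exists [seq zdeg m | m <- msupp (ei_val v : {mpoly K[n]})].
exists (fun a => if zdeg (mon a) == a then t a else 0); split.
  move=> a; case: eqP => [ha|_]; last exact: ei_comp0.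
  by move=> m /= /msuppZ_le; rewrite msuppX inE => /eqP ->.
apply: val_inj; rewrite big_map /= ei_val_sum {1}[LHS]mpolyE.
by apply: eq_bigr => m _; rewrite monK eqxx /= monK.
Qed.

Fact ei_indep (A : seq (zdegree n)) (u : zdegree n -> edge_ideal_mod) :
  uniq A -> (forall a, ei_comp a (u a)) -> \sum_(a <- A) u a = 0 ->
  forall a, a \in A -> u a = 0.
Proof.
move=> uA hu s0 a aA; apply: val_inj; apply/mpolyP=> m /=.
rewrite mcoeff0; apply/eqP; apply: contraT; rewrite -mcoeff_msupp => hm.
have := congr1 (fun p : edge_ideal_mod => (ei_val p : {mpoly K[n]})@_m) s0.
rewrite ei_val_sum /= mcoeff0 raddf_sum /= (bigD1_seq a) //= big1 ?addr0.
  by move/eqP; rewrite mcoeff_eq0 hm.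
move=> b ba; apply/eqP; rewrite mcoeff_eq0; apply: contra ba => /hu <-.
by rewrite (hu _ _ hm).
Qed.

Definition edge_ideal_module : gradedModule K n :=
  GradedModule ei_comp0 ei_compD ei_compX ei_span ei_indep.

End EdgeIdealModule.

(* Main.v *)
(* A partition of the non-independent vertex sets into intervals [C, D]
   yields the Stanley decomposition of the edge ideal into the spaces
   x_C K[D].  Cut the path into blocks of 2k+1 consecutive vertices.  Given a
   non-independent A, the vertices beyond the first block at whose end A has
   acquired an edge may be toggled freely.  In an earlier block the centre may
   be toggled if A contains no other vertex of the block: its neighbours all
   lie in the block.  So each block contributes at least one vertex to D, and
   one block must contribute two.  A block in which A acquires its first edge
   does so unless that edge comes from the right half of the previous block.
   In the first block where A has a vertex i right of the centre, i - k - 1 is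
   not adjacent to i, nor to any vertex of A in the previous block, so it may
   be toggled if A contains no other vertex of the block. *)

Require Import Defs.
From mathcomp Require Import all_boot all_order all_algebra.
From mathcomp Require Import boolp mpoly zify.

Set Implicit Arguments.
Unset Strict Implicit.
Unset Printing Implicit Defensive.

Local Open Scope ring_scope.

Import Order.TTheory GRing.Theory Num.Theory.

(** * Stanley decompositions from interval partitions *)

Definition dependent (T : finType) (e : rel T) (A : {set T}) : bool :=
  [exists i in A, exists j in A, e i j].

Section IntervalPartition.
Variables (K : fieldType) (n : nat) (e : rel 'I_n).
Hypothesis e_irr : irreflexive e.

Definition mnm_supp (m : 'X_{1..n}) : {set 'I_n} := [set i | m i != 0%N].

Definition mnm_set (A : {set 'I_n}) : 'X_{1..n} :=
  [multinom (i \in A : nat) | i < n].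

Lemma mnm_supp_set A : mnm_supp (mnm_set A) = A.
Proof. by apply/setP=> i; rewrite inE mnmE; case: (i \in A). Qed.

Lemma mnm_set_le A m : (mnm_set A <= m)%MM = (A \subset mnm_supp m).
Proof.
apply/mnm_lepP/subsetP => [h i iA|h i].
  by have := h i; rewrite mnmE iA inE lt0n.
by rewrite mnmE; case: (boolP (i \in A)) => // /h; rewrite inE lt0n.
Qed.

Lemma edge_ideal_msupp (p : {mpoly K[n]}) m :
  p \in edge_ideal K e -> m \in msupp p -> dependent e (mnm_supp m).
Proof.
rewrite mcoeff_msupp /in_mem /= => /asboolP[q ->] nz.
have /existsP[i /existsP[j /andP[eij]]] :
  [exists i, exists j, e i j && ((q i j * ('X_i * 'X_j))@_m != 0)].
  apply: contraNT nz => /existsPn h; rewrite raddf_sum big1 // => i _ /=.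
  rewrite raddf_sum big1 // => j eij /=.
  by have /existsPn/(_ j) := h i; rewrite eij negbK => /eqP.
rewrite -mpolyXD -mcoeff_msupp (perm_mem (msuppMX _ _)) => /mapP[h _ ->].
apply/existsP; exists i; rewrite inE !mnmDE mnm1E eqxx /=.
apply/existsP; exists j; rewrite inE !mnmDE (mnm1E j j) eqxx eij.
by rewrite andbT !addn_eq0 !andbF.
Qed.

Lemma mnm_set_edge_ideal A :
  dependent e A -> ('X_[mnm_set A] : {mpoly K[n]}) \in edge_ideal K e.
Proof.
move=> /existsP[i /andP[iA /existsP[j /andP[jA eij]]]].
have ij : i != j by apply: contraTneq eij => ->; rewrite e_irr.
rewrite /in_mem /=; apply/asboolP.
exists (fun i' j' => if (i' == i) && (j' == j) then
   'X_[(mnm_set A - (U_(i) + U_(j)))%MM] else 0).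
rewrite (bigD1 i) //= (bigD1 j) //= !eqxx /= -!mpolyXD submK; last first.
  apply/mnm_lepP=> l; rewrite mnmDE !mnm1E mnmE.
  have [<-|] := eqVneq i l; first by rewrite eq_sym (negPf ij) iA.
  by have [<-|] := eqVneq j l; rewrite ?jA.
rewrite big1 => [|j' /andP[_ /negPf ->]]; last by rewrite mul0r.
rewrite addr0 big1 ?addr0 // => i' /negPf ->.
by rewrite big1 // => j' _; rewrite mul0r.
Qed.

Local Notation M := (edge_ideal_module K e).

(** Since [A] lies in [W], exponents on [A] may grow freely, so membership depends only on the
    supports of the monomials. *)
Lemma stanley_space_msupp (A W : {set 'I_n}) (g u : M) :
  A \subset W -> ei_val g = 'X_[mnm_set A] ->
  stanley_space g W u <->
  (forall m, m \in msupp (ei_val u : {mpoly K[n]}) ->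
     A \subset mnm_supp m /\ mnm_supp m \subset W).
Proof.
move=> AW gA; split=> [[p [pW ->]] m|h].
  have -> : ei_val (p *: g) = p * 'X_[mnm_set A] by rewrite -gA.
  rewrite (perm_mem (msuppMX _ _)) => /mapP[l lp ->].
  rewrite -mnm_set_le lem_addr //; split=> //; apply/subsetP=> i.
  rewrite inE mnmDE mnmE addn_eq0 negb_and orbC.
  by case/orP=> [/(pW _ lp) //|]; case: (boolP (i \in A)) => // /(subsetP AW).
pose p : {mpoly K[n]} := \sum_(m <- msupp (ei_val u : {mpoly K[n]}))
  (ei_val u : {mpoly K[n]})@_m *: 'X_[(m - mnm_set A)%MM].
exists p; split.
  move=> l /msupp_sum_le /flattenP[s /mapP[m]].
  rewrite filter_predT => mu -> /msuppZ_le; rewrite msuppX inE => /eqP -> i.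
  rewrite mnmBE => nz; have [_ /subsetP] := h m mu; apply; rewrite inE.
  by apply: contraNneq nz => ->.
apply: val_inj => /=; rewrite gA -[RHS]/(p * 'X_[mnm_set A]).
rewrite {1}[ei_val u]mpolyE mulr_suml !big_seq; apply: eq_bigr => m mu.
by rewrite -scalerAl -mpolyXD submK // mnm_set_le; case: (h m mu).
Qed.

Lemma ei_val_sum (I : finType) (u : I -> M) :
  ei_val (\sum_i u i) = \sum_i ei_val (u i).
Proof. by apply: (big_morph (@ei_val K n e)). Qed.

(* [F A] is the set of vertices that may be freely added to or removed from
   [A]: the blocks of the partition are the intervals
   [A :\: F A, A :|: F A]. *)
Variable F : {set 'I_n} -> {set 'I_n}.
Hypothesis F_interval : forall A B, dependent e A ->
  A :\: F A = B :\: F A -> dependent e B /\ F A \subset F B.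

(** As [F A] lies in [F B], the sets also agree off [F B], so [F_interval] applies with the roles
    exchanged. *)
Lemma F_interval_eq A B :
  dependent e A -> A :\: F A = B :\: F A -> F B = F A.
Proof.
move=> dA AB; have [dB sAB] := F_interval dA AB.
apply/eqP; rewrite eqEsubset sAB andbT.
have [] // := F_interval (A := B) (B := A) dB.
apply/setP=> i; have /setP/(_ i) := AB; rewrite !inE.
have /implyP := subsetP sAB i.
by case: (i \in F A); case: (i \in F B).
Qed.

(** These sets index the intervals: each interval contains exactly one of them, its minimum. *)
Definition interval_mins : {set {set 'I_n}} :=
  [set A | dependent e A && [disjoint A & F A]].

Lemma interval_min_of A : dependent e A ->
  A :\: F A \in interval_mins /\ F (A :\: F A) = F A.
Proof.
move=> dA; have AB : A :\: F A = (A :\: F A) :\: F A by rewrite setDDl setUid.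
have [dB _] := F_interval dA AB; have FB := F_interval_eq dA AB.
by rewrite inE dB FB; split=> //; 
  rewrite disjoints_subset setDE subsetIr.
Qed.

Lemma interval_min_uniq (A C : {set 'I_n}) : C \in interval_mins ->
  C \subset A -> A \subset C :|: F C -> dependent e A /\ A :\: F A = C.
Proof.
rewrite inE => /andP[dC dis] CA AC.
have CF : C :\: F C = A :\: F C.
  apply/setP=> i; rewrite !inE; have /implyP := subsetP CA i.
  have /implyP := subsetP AC i; rewrite inE.
  by case: (i \in F C); case: (i \in C); case: (i \in A).
have [dA _] := F_interval dC CF; split=> //.
by rewrite (F_interval_eq dC CF) -CF; apply/setDidPl.
Qed.

Definition interval_gen (i : 'I_#|interval_mins|) : M :=
  match pselect (dependent e (enum_val i)) with
  | left d => EdgeIdealMod (mnm_set_edge_ideal d)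
  | right _ => 0
  end.

Lemma interval_genE i : ei_val (interval_gen i) = 'X_[mnm_set (enum_val i)].
Proof.
rewrite /interval_gen; case: pselect => // - [].
by have := enum_valP i; rewrite inE => /andP[].
Qed.

Definition interval_vars (i : 'I_#|interval_mins|) : {set 'I_n} :=
  enum_val i :|: F (enum_val i).

Lemma interval_homogeneous i : gm_homogeneous (interval_gen i).
Proof.
exists (zdeg (mnm_set (enum_val i))); rewrite /= /ei_comp => m.
by rewrite interval_genE msuppX inE => /eqP ->.
Qed.

Lemma interval_free i : stanley_free (interval_gen i) (interval_vars i).
Proof.
move=> p _ /(congr1 (fun u : M => ei_val u : {mpoly K[n]})).
have -> : ei_val (p *: interval_gen i) = p * 'X_[mnm_set (enum_val i)].
  by rewrite -interval_genE.
move/eqP; rewrite mulf_eq0 => /orP[/eqP //|/eqP X0].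
have := mcoeffX K (mnm_set (enum_val i)) (mnm_set (enum_val i)).
by rewrite X0 mcoeff0 eqxx => /eqP; rewrite eq_sym oner_eq0.
Qed.

Lemma interval_spaceP i u :
  stanley_space (interval_gen i) (interval_vars i) u <->
  (forall m, m \in msupp (ei_val u : {mpoly K[n]}) ->
     dependent e (mnm_supp m) /\ mnm_supp m :\: F (mnm_supp m) = enum_val i).
Proof.
rewrite (stanley_space_msupp u (subsetUl _ _) (interval_genE i)).
split=> h m /h; first by case; apply: interval_min_uniq (enum_valP i).
case=> dm <-; have [_ ->] := interval_min_of dm; split; first exact: subsetDl.
by apply/subsetP=> v vm; rewrite in_setU in_setD vm andbT orNb.
Qed.

(** The component of [v] in an interval collects the terms whose support lies in it; every such
    support is dependent, hence in exactly one interval. *)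
Lemma interval_direct (v : M) :
  exists! u : {ffun 'I_#|interval_mins| -> M},
    (forall i, stanley_space (interval_gen i) (interval_vars i) (u i)) /\
    v = \sum_i u i.
Proof.
pose cell m := mnm_supp m :\: F (mnm_supp m).
pose part C : {mpoly K[n]} :=
  \sum_(m <- msupp (ei_val v : {mpoly K[n]}) | cell m == C)
    (ei_val v : {mpoly K[n]})@_m *: 'X_[m].
have part_in C : part C \in edge_ideal K e.
  by apply: rpred_sum => m _; apply: edge_ideal_term (valP v).
have partE C m : (part C)@_m =
    if cell m == C then (ei_val v : {mpoly K[n]})@_m else 0.
  have [mv|mv] := boolP (m \in msupp (ei_val v : {mpoly K[n]})); last first.
    rewrite (memN_msupp_eq0 mv) if_same raddf_sum big_seq_cond big1 //= => l.
    case/andP=> lv _; rewrite mcoeffZ mcoeffX.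
    by have [lm|] := eqVneq l m; [rewrite -lm lv in mv | rewrite mulr0].
  rewrite raddf_sum big_mkcond (bigD1_seq m) ?msupp_uniq //=.
  rewrite mcoeffZ mcoeffX eqxx mulr1 big1 ?addr0 // => l lm.
  by rewrite mcoeffZ mcoeffX (negPf lm) mulr0 if_same.
have v_dep m : m \in msupp (ei_val v : {mpoly K[n]}) ->
    dependent e (mnm_supp m) by apply: edge_ideal_msupp (valP v).
exists [ffun i => EdgeIdealMod (part_in (enum_val i))]; split; first split.
- move=> i; rewrite ffunE; apply/interval_spaceP => m /=.
  rewrite mcoeff_msupp partE; case: (cell m =P _) => [mC|_].
    by rewrite -mcoeff_msupp => /v_dep.
  by rewrite eqxx.
- apply: val_inj => /=; rewrite ei_val_sum; apply/mpolyP=> m.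
  rewrite raddf_sum /=.
  have [mv|mv] := boolP (m \in msupp (ei_val v : {mpoly K[n]})); last first.
    rewrite (memN_msupp_eq0 mv) big1 // => i _; rewrite ffunE partE.
    by rewrite (memN_msupp_eq0 mv) if_same.
  have [cm _] := interval_min_of (v_dep m mv).
  rewrite (bigD1 (enum_rank_in cm (cell m))) //= ffunE partE enum_rankK_in //.
  rewrite eqxx big1 ?addr0 // => i; rewrite ffunE partE.
  by case: (cell m =P _) => // mi; rewrite mi enum_valK_in eqxx.
move=> u [uS vE]; apply/ffunP=> i; rewrite ffunE; apply: val_inj => /=.
apply/mpolyP=> m; rewrite partE vE ei_val_sum raddf_sum /=.
(* Distinct spaces share no monomial, so the coefficient at [m] comes from a single summand. *)
have u0 j : cell m != enum_val j -> (ei_val (u j) : {mpoly K[n]})@_m = 0.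
  move=> mj; apply: memN_msupp_eq0; apply: contra mj => mu.
  by have /interval_spaceP/(_ m mu)[_ /eqP] := uS j.
case: (cell m =P _) => [mi|/eqP /u0 //].
rewrite (bigD1 i) //= big1 ?addr0 // => j ji.
by apply: u0; rewrite mi (inj_eq enum_val_inj) eq_sym.
Qed.

Lemma sdepth_ge d :
  (d <= n)%N -> (forall A, dependent e A -> d <= #|A :|: F A|)%N ->
  (d <= sdepth M)%N.
Proof.
move=> dn dF.
pose D :=
  StanleyDecomposition interval_homogeneous interval_free interval_direct.
have Dn : (sdepth_decomp D < n.+1)%N.
  rewrite ltnS /sdepth_decomp; apply: (big_ind (fun x => x <= n)%N) => //.
    by move=> x y xn _; rewrite geq_min xn.
  by move=> i _; rewrite -[leqRHS]card_ord max_card.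
apply: leq_trans (leq_bigmax_cond (Ordinal Dn) _); last first.
  by apply/asboolP; exists D.
rewrite /= /sdepth_decomp; apply: (big_ind (fun x => d <= x)%N) => //.
  by move=> x y dx dy; rewrite leq_min dx.
by move=> i _; apply: dF; have := enum_valP i; rewrite inE => /andP[].
Qed.

End IntervalPartition.

Local Open Scope nat_scope.

(** * Toggle vertices in blocks of [2 * k + 1] vertices *)

Section Blocks.
Variable k : nat.
Local Notation w := (2 * k + 1)%N.

(** Edges of length at most [k] reach no further than the next block, and then start at offset at
    least [w - k = k + 1]. *)
Lemma block_edge a b : a < b -> b - a <= k -> a %/ w != b %/ w ->
  a %% w > k /\ b %/ w = (a %/ w).+1.
Proof.
have := divn_eq a w; have := divn_eq b w.
have := @ltn_pmod a w; have := @ltn_pmod b w.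
move: (a %/ w) (a %% w) (b %/ w) (b %% w) => p r q s; nia.
Qed.

Lemma divn_modn_unique q r : r < w ->
  (q * w + r) %/ w = q /\ (q * w + r) %% w = r.
Proof. by move=> rw; rewrite divnMDl ?modnMDl ?divn_small ?modn_small; lia. Qed.

Lemma block_shift v : v %% w < k ->
  (v + k + 1) %/ w = v %/ w /\ (v + k + 1) %% w = v %% w + k + 1.
Proof.
move=> h; have -> : v + k + 1 = v %/ w * w + (v %% w + k + 1).
  by rewrite {1}(divn_eq v w); lia.
by apply: divn_modn_unique; lia.
Qed.

Lemma block_unshift v : k < v %% w ->
  [/\ (v - k - 1) %/ w = v %/ w, (v - k - 1) %% w < k & v - k - 1 + k + 1 = v].
Proof.
have := @ltn_pmod v w; have := divn_eq v w.
move: (v %/ w) (v %% w) => q r -> rw rk.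
have -> : q * w + r - k - 1 = q * w + (r - k - 1) by lia.
have [|-> ->] := @divn_modn_unique q (r - k - 1); first by lia.
by split; lia.
Qed.

Variable n : nat.
Implicit Types (A B : {set 'I_n}) (v : 'I_n).

Lemma block_unique_left u v : u < v -> v - u <= k -> u %% w <= k ->
  u %/ w = v %/ w.
Proof.
by move=> uv vu uk; apply/eqP; apply: contraLR uk => /(block_edge uv vu)[]; lia.
Qed.

Definition settled A j : Prop := exists a b : 'I_n,
  [/\ a \in A, b \in A, a < b, b - a <= k & b %/ w < j].

(* The toggle vertex of a block without edges: the centre, or the partner
   [u - k - 1] of a vertex [u] right of the centre, when no earlier block has
   a vertex right of its centre. *)
Definition loose A v : Prop :=
  [/\ v %% w <= k,
      forall u, u \in A -> u %/ w = v %/ w -> u = v \/ u = v + k + 1 :> nat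
    & v %% w = k \/
      (exists2 u : 'I_n, u \in A & u = v + k + 1 :> nat) /\
      (forall u, u \in A -> u %/ w < v %/ w -> u %% w <= k)].

(** In the block where the first edge of [A] is completed both alternatives fail, so that block has
    no free vertex. *)
Definition free_vertices A : {set 'I_n} :=
  [set v : 'I_n |
    `[< settled A (v %/ w) \/ ~ settled A (v %/ w).+1 /\ loose A v >]].

Local Notation F := free_vertices.

Lemma free_verticesP A v : reflect
  (settled A (v %/ w) \/ ~ settled A (v %/ w).+1 /\ loose A v) (v \in F A).
Proof. by rewrite inE; apply: asboolP. Qed.

Lemma settled_leq A i j : i <= j -> settled A i -> settled A j.
Proof. by move=> ij [a [b [aA bA ab ba bi]]]; exists a, b; split=> //; lia. Qed.

Lemma unsettled_loose A v j : v %/ w < j -> ~ settled A j ->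
  v \in F A -> loose A v.
Proof.
move=> vj nA /free_verticesP[h|[]//].
by case: nA; apply: settled_leq h; apply: ltnW.
Qed.

(** A loose vertex left of the centre has its partner in [A], and this must also be the partner of
    any other loose vertex of the block. Otherwise both are the centre. *)
Lemma loose_unique A u v : loose A u -> loose A v -> u %/ w = v %/ w ->
  u = v :> nat.
Proof.
have left_case x y : loose A x -> loose A y -> x %/ w = y %/ w ->
    x %% w < k -> x = y :> nat.
  move=> [_ _ xS] [yk yA _] xy xk; have [h1 h2] := block_shift xk.
  case: xS => [xk'|[[z zA zx] _]]; first by lia.
  have zb : z %/ w = y %/ w by rewrite zx h1.
  have [zy|] := yA z zA zb; last by lia.
  by move: yk; rewrite -zy zx h2; lia.
move=> lu lv uv; have [uk _ _] := lu; have [vk _ _] := lv.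
have [uk'|uk'] := ltnP (u %% w) k; first exact: left_case.
have [vk'|vk'] := ltnP (v %% w) k; first by apply/esym/left_case.
by rewrite (divn_eq u w) (divn_eq v w) uv; congr (_ + _); lia.
Qed.

(** Within its block a loose vertex meets at most its partner, at distance [k + 1]. An edge across a
    boundary has its left end right of the centre, hence not loose. *)
Lemma unsettled_no_edge A j a b : ~ settled A j -> a \in A :|: F A ->
  b \in A :|: F A -> a < b -> b - a <= k -> b %/ w < j -> False.
Proof.
move=> nA aAF bAF ab ba bj.
have aj : a %/ w < j by apply: leq_ltn_trans bj; apply: leq_div2r; apply: ltnW.
have [bF|bF] := boolP (b \in F A).
  have lb := unsettled_loose bj nA bF; have [bk bA bS] := lb.
  have [ab'|ab'] := eqVneq (a %/ w) (b %/ w).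
    have [aF|aF] := boolP (a \in F A).
      by have := loose_unique (unsettled_loose aj nA aF) lb ab'; lia.
    have aA : a \in A by move: aAF; rewrite in_setU (negPf aF) orbF.
    by have [/(congr1 val)|] := bA a aA ab'; rewrite /=; lia.
  have [ak bE] := block_edge ab ba ab'.
  have [aF|aF] := boolP (a \in F A).
    by have [] := unsettled_loose aj nA aF; lia.
  have aA : a \in A by move: aAF; rewrite in_setU (negPf aF) orbF.
  (* A centre is too far from the previous block; otherwise looseness of [b] forbids [a]. *)
  case: bS => [bk'|[_ /(_ a aA)]]; last by lia.
  have := divn_eq a w; have := divn_eq b w; rewrite bE.
  have := @ltn_pmod a w; lia.
have bA : b \in A by move: bAF; rewrite in_setU (negPf bF) orbF.
have [aF|aF] := boolP (a \in F A); last first.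
  have aA : a \in A by move: aAF; rewrite in_setU (negPf aF) orbF.
  by apply: nA; exists a, b.
have [ak aA _] := unsettled_loose aj nA aF.
have ba' := block_unique_left ab ba ak.
by have [/(congr1 val)|] := aA b bA (esym ba'); rewrite /=; lia.
Qed.

Lemma settledS A j : settled A j.+1 -> ~ settled A j -> exists a b : 'I_n,
  [/\ a \in A, b \in A, a < b, b - a <= k & b %/ w = j].
Proof.
move=> [a [b [aA bA ab ba bj]]] nA; exists a, b; split=> //.
apply/eqP; rewrite eqn_leq -ltnS bj /= leqNgt.
by apply/negP=> bj'; apply: nA; exists a, b.
Qed.

(** * Invariance of the free vertices along an interval *)

Section Interval.
Variables A B : {set 'I_n}.
Hypothesis AB : A :\: F A = B :\: F A.

Lemma interval_sub v : v \in B -> v \in A :|: F A.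
Proof.
by move/setP/(_ v): AB; rewrite !inE; case: asboolP; case: (v \in A) => //= _ <-.
Qed.

Lemma interval_fixed v : v \notin F A -> (v \in A) = (v \in B).
Proof. by move=> vF; move/setP/(_ v): AB; rewrite !in_setD vF. Qed.

(** Toggling creates no edge in unsettled blocks. Conversely the first edge survives: the block
    where it ends has no free vertex, and an end in the previous block is right of the centre, hence
    not loose. *)
Lemma interval_settled j : settled A j <-> settled B j.
Proof.
split; last first.
  move=> [a [b [/interval_sub aAF /interval_sub bAF ab ba bj]]].
  by apply: contrapT => nA; apply: unsettled_no_edge nA aAF bAF ab ba bj.
elim: j => [|j IH] sA; first by case: sA => [a [b []]].
have [/IH|nA] := pselect (settled A j); first exact: settled_leq.
have [a [b [aA bA ab ba bj]]] := settledS sA nA.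
have last_fixed (u : 'I_n) : u %/ w = j -> u \notin F A.
  by move=> uj; apply/free_verticesP; rewrite uj; case=> [|[]].
exists a, b; split=> //; last by rewrite bj.
- rewrite -interval_fixed //; have [aj|aj] := eqVneq (a %/ w) (b %/ w).
    by apply: last_fixed; rewrite aj.
  have [ak bE] := block_edge ab ba aj; apply/negP=> aF.
  have aj' : a %/ w < j by rewrite -bj bE.
  by have [] := unsettled_loose aj' nA aF; lia.
- by rewrite -interval_fixed //; apply: last_fixed.
Qed.

(** In unsettled blocks no free vertex is right of the centre, so [A] and [B] agree there; by
    [loose_unique], [v] is the only free vertex of its block. *)
Lemma interval_free_vertices : F A \subset F B.
Proof.
apply/subsetP=> v /free_verticesP[sA|[nA vA]].
  by apply/free_verticesP; left; apply/interval_settled.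
apply/free_verticesP; right; split; first by move/interval_settled.
have [vk vblock vS] := vA; split=> // [u uB uv|].
  have [uF|/interval_fixed uE] := boolP (u \in F A).
    left; apply/val_inj; apply: (loose_unique (A := A)) => //.
    by apply: unsettled_loose nA uF; rewrite uv.
  by apply: vblock => //; rewrite uE.
have [vk'|vk'] := eqVneq (v %% w) k; [by left | right].
case: vS => [/eqP|[[x xA xv] noR]]; first by rewrite (negPf vk').
have [|xb xm] := @block_shift v; first by lia.
have loose_left (u : 'I_n) : u %/ w <= v %/ w -> u \in F A -> u %% w <= k.
  by move=> uv uF; have [] := unsettled_loose (j := (v %/ w).+1) uv nA uF.
split.
  exists x => //; rewrite -interval_fixed //; apply/negP => /loose_left.
  by rewrite xv xb xm leqnn; lia.
move=> u uB uv; have [uF|/interval_fixed uE] := boolP (u \in F A).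
  by apply: loose_left uF; apply: ltnW.
by apply: noR => //; rewrite uE.
Qed.

End Interval.

(** * Counting vertices block by block *)

Section Count.
Variables (A : {set 'I_n}) (N : nat).
Hypothesis sA : settled A N.

(** Past the first edge every vertex is free; the block where it ends contains its right end; an
    earlier block has a vertex of [A] or a free centre. *)
Lemma block_nonempty j : j < (n.-1 %/ w).+1 ->
  exists2 v : 'I_n, v \in A :|: F A & v %/ w = j.
Proof.
rewrite ltnS => jn; have [a0 [b0 [a0A b0A ab0 ba0 _]]] := sA.
have n0 : 0 < n by apply: leq_trans (ltn_ord b0).
have [sj|nj] := pselect (settled A j).
  have lt : j * w < n.
    by have := leq_trunc_div n.-1 w; nia.
  have jE : (j * w) %/ w = j by rewrite mulnK; lia.
  exists (Ordinal lt) => //; rewrite in_setU; apply/orP; right.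
  by apply/free_verticesP; left; rewrite /= jE.
have [sj|nj'] := pselect (settled A j.+1).
  have [a [b [aA bA ab ba bj]]] := settledS sj nj.
  by exists b; rewrite ?in_setU ?bA.
(* The centre exists because an edge of [A] ends in a later block. *)
have lt : j * w + k < n.
  have b0j : j < b0 %/ w.
    by rewrite ltnNge; apply/negP=> h; apply: nj'; exists a0, b0.
  by have := leq_trunc_div b0 w; have := ltn_ord b0; nia.
have [|cj cm] := @divn_modn_unique j k; first by lia.
have [[u uA uj]|noA] := pselect (exists2 u : 'I_n, u \in A & u %/ w = j).
  by exists u; rewrite ?in_setU ?uA.
exists (Ordinal lt) => //; rewrite in_setU; apply/orP; right.
apply/free_verticesP; right; rewrite /= cj; split=> //.
split; rewrite /= ?cm ?cj //; last by left.
by move=> u uA uj; case: noA; exists u.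
Qed.

Lemma block_double : exists x y : 'I_n,
  [/\ x \in A :|: F A, y \in A :|: F A, x != y & x %/ w = y %/ w].
Proof.
have [j sj nj] : exists2 j, settled A j.+1 & ~ settled A j.
  elim: N sA => [[a [b []]] //|i IH si].
  by have [/IH //|ni] := pselect (settled A i); exists i.
have [a [b [aA bA ab ba bj]]] := settledS sj nj.
pose P (u : 'I_n) := [&& u \in A, u %/ w < j & k < u %% w].
have [aj|aj] := eqVneq (a %/ w) (b %/ w).
  by exists a, b; rewrite !in_setU aA bA; split=> //; rewrite neq_ltn ab.
have [ak bE] := block_edge ab ba aj.
have Pa : P a by rewrite /P aA ak -bj bE ltnSn.
(* Taking the earliest block with a vertex of [A] right of the centre secures the last condition of
   [loose] for [u - k - 1]. *)
case: (arg_minnP (fun u : 'I_n => u %/ w) Pa) => u /and3P[uA uj uk] umin.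
have [[y yA [yu yj]]|noA] :=
    pselect (exists2 y : 'I_n, y \in A & y != u /\ y %/ w = u %/ w).
  by exists y, u; rewrite !in_setU yA uA.
have [vb vm vu] := block_unshift uk.
have lt : u - k - 1 < n.
  by rewrite -subnDA (leq_ltn_trans (leq_subr _ _)) ?ltn_ord.
exists u, (Ordinal lt); split; rewrite ?in_setU ?uA //=.
- apply/orP; right; apply/free_verticesP; right; rewrite /= vb.
  split; first by move=> h; apply: nj; apply: settled_leq h.
  split; rewrite /= ?vb; first exact: ltnW.
    move=> y yA yb; right; rewrite vu; have [->//|yu] := eqVneq y u.
    by case: noA; exists y.
  right; split; first by exists u; rewrite ?vu.
  move=> y yA yu; rewrite leqNgt; apply/negP=> yk.
  have /umin : P y by rewrite /P yA yk (ltn_trans yu uj).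
  by rewrite leqNgt yu.
- rewrite -val_eqE /= -{1}vu -addnA -[X in _ != X]addn0 eqn_add2l.
  by rewrite addn1.
Qed.

(** Every block is still met after [y] is removed, because [x] lies in the same block. *)
Lemma card_free_vertices : (n.-1 %/ w).+2 <= #|A :|: F A|.
Proof.
have [x [y [xX yX xy xyb]]] := block_double.
rewrite (cardsD1 y) yX add1n ltnS.
set X := _ :\ y; pose f (v : 'I_n) : 'I_(n.-1 %/ w).+1 := inord (v %/ w).
rewrite -[leqLHS]card_ord -cardsT; apply: leq_trans (leq_imset_card f X).
apply: subset_leq_card; apply/subsetP=> j _.
have [v vX vj] := block_nonempty (ltn_ord j).
have [vy|vy] := eqVneq v y; apply/imsetP.
  by exists x; rewrite ?in_setD1 ?xy ?xX // /f xyb -vy vj inord_val.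
by exists v; rewrite ?in_setD1 ?vy ?vX // /f vj inord_val.
Qed.

End Count.
End Blocks.

Local Close Scope nat_scope.

Lemma path_power_dependent n k (A : {set 'I_n}) :
  dependent (path_power n k) A <-> settled k A n.
Proof.
(* Every block number is below [n], so the bound [n] in [settled] admits every edge. *)
have blk (b : 'I_n) : (b %/ (2 * k + 1) < n)%N.
  exact: leq_ltn_trans (leq_div _ _) (ltn_ord b).
split=> [/existsP[i /andP[iA /existsP[j /andP[jA]]]]|].
  by case/orP=> /andP[ij jk]; [exists i, j | exists j, i].
move=> [a [b [aA bA ab ba _]]].
apply/existsP; exists a; rewrite aA; apply/existsP; exists b.
by rewrite bA /path_power ab ba.
Qed.

Theorem theorem5p2 (K : fieldType) (n k : nat)
    (hk : (1 <= k)%N) (hn : (2 <= n)%N) :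
  Num.ceil (n%:R / (2 * k + 1)%:R : rat) + 1
    <= (sdepth (edge_ideal_module K (path_power n k)))%:Z.
Proof.
set w := (2 * k + 1)%N; have w0 : (0 < w)%N by rewrite /w addn1.
have path_irr : irreflexive (path_power n k).
  by move=> i; rewrite /path_power ltnn.
have card_ge (A : {set 'I_n}) : dependent (path_power n k) A ->
    ((n.-1 %/ w).+2 <= #|A :|: free_vertices k A|)%N.
  by move/path_power_dependent/card_free_vertices.
have interval (A B : {set 'I_n}) : dependent (path_power n k) A ->
    A :\: free_vertices k A = B :\: free_vertices k A ->
    dependent (path_power n k) B /\ free_vertices k A \subset free_vertices k B.
  move=> /path_power_dependent sA AB; split.
    by apply/path_power_dependent/(interval_settled AB).
  exact: interval_free_vertices.
(* This is the cardinality bound for the full vertex set, which contains the edge between the first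
   two vertices. *)
have dn : ((n.-1 %/ w).+2 <= n)%N.
  have dT : dependent (path_power n k) setT.
    have n0 : (0 < n)%N by apply: ltnW.
    apply/existsP; exists (Ordinal n0); rewrite inE.
    by apply/existsP; exists (Ordinal hn); rewrite inE /path_power /= hk.
  by rewrite -[leqRHS]card_ord (leq_trans (card_ge _ dT)) ?max_card.
have := sdepth_ge K path_irr interval dn card_ge.
rewrite -lez_nat; apply: le_trans.
(* The ceiling of [n / w] is at most [n.-1 %/ w + 1], because [n <= (n.-1 %/ w + 1) * w]. *)
rewrite -[X in _ <= X%:Z]addn1 PoszD lerD2r ceil_le_int ler_pdivrMr ?ltr0n //.
by rewrite -pmulrn -natrM ler_nat -(ltn_predK hn) ltn_ceil.
Qed.
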